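(* Let $d,n$ be positive integers. For integers $e\geq 0$ let $U_e(n)=\sum_{k=1}^n \frac{2^{2k}}{\binom{2k}{k}} k^e$ and $V_e(n)=\sum_{k=1}^n \frac{2^{2k}}{\binom{2k}{k}} k^e H_k$. Then \[ (2d+3)V_d(n) = \frac{(n+1)2^{2n+1} n^d H_{n+1}}{\binom{2n}{n}} - \sum_{j=1}^d (-1)^j c_{d,j}V_{d-j}(n) - 2U_d(n), \] where $c_{d,j} = \binom{d+1}{j+1} + \binom{d}{j+1}$, and where \[ V_0(n) = - \frac{2}{9} + \frac{2^{2n+1}}{3\binom{2n}{n}}\left ( (n+1)H_n - \frac{2n-1}{3} \right ). \]
   Context: $H_k=\sum_{j=1}^k 1/j$ denotes the $k$-th harmonic number. Binomial coefficients $\binom{a}{b}$ with integers $0\le a<b$ are $0$. *)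

(* Defs.v *)
From mathcomp Require Import all_boot all_order all_algebra.

Set Implicit Arguments.
Unset Strict Implicit.
Unset Printing Implicit Defensive.

Import Order.TTheory GRing.Theory Num.Theory.
Local Open Scope ring_scope.

Definition harmonic (k : nat) : rat := \sum_(1 <= j < k.+1) j%:R^-1.

Definition U (e n : nat) : rat :=
  \sum_(1 <= k < n.+1) 2 ^+ (2 * k) / 'C(2 * k, k)%:R * k%:R ^+ e.

Definition V (e n : nat) : rat :=
  \sum_(1 <= k < n.+1)
    2 ^+ (2 * k) / 'C(2 * k, k)%:R * k%:R ^+ e * harmonic k.

Definition c (d j : nat) : rat := 'C(d.+1, j.+1)%:R + 'C(d, j.+1)%:R.

(* Main.v *)
(* With [a k = 4^k / 'C(2k, k)], the recurrence [(2k + 1) a (k+1) = 2 (k + 1) a k]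
   makes [2 (k + 1) a k k^d H_(k+1)] a discrete antiderivative: its increment from
   [k - 1] to [k] is [a k (2 k^d + H_k (2 (k + 1) k^d - (2k - 1) (k - 1)^d))].
   Expanding the polynomial factor by the binomial theorem produces the
   coefficients [c d j], and summing over [k] gives the recurrence for [V d]. *)
Require Import Defs.
From mathcomp Require Import all_boot all_order all_algebra.
From mathcomp Require Import ring.

Import Order.TTheory GRing.Theory Num.Theory.
Local Open Scope ring_scope.

Definition weight (k : nat) : rat := 2 ^+ (2 * k) / 'C(2 * k, k)%:R.

Lemma weight0 : weight 0 = 1.
Proof. by rewrite /weight muln0 bin0 expr0 divr1. Qed.

(** Pascal's rule and the symmetry of row [2k + 1] give [C(2k+2, k+1) = 2 C(2k+1, k+1)]; absorbing
    the factor [k + 1] then lands on [C(2k, k)]. *)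
Lemma central_binS (k : nat) :
  (k.+1 * 'C(2 * k.+1, k.+1) = 2 * (2 * k).+1 * 'C(2 * k, k))%N.
Proof.
have le_k : (k.+1 <= (2 * k).+1)%N by rewrite ltnS leq_pmull.
have bin_half : 'C((2 * k).+1, k.+1) = 'C((2 * k).+1, k).
  by rewrite -(bin_sub le_k) subSS mul2n -addnn addnK.
rewrite mulnS binS -bin_half addnn -mul2n mulnCA -(mul_bin_diag (2 * k).+1) /=.
by rewrite mulnA.
Qed.

Lemma weightS (k : nat) :
  (2 * k%:R + 1) * weight k.+1 = 2 * (k%:R + 1) * weight k.
Proof.
have C_neq0 : 'C(2 * k, k)%:R != 0 :> rat.
  by rewrite pnatr_eq0 -lt0n bin_gt0 leq_pmull.
have k1 : k%:R + 1 != 0 :> rat by rewrite natr1 pnatr_eq0.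
have k21 : 2 * k%:R + 1 != 0 :> rat by rewrite -natrM natr1 pnatr_eq0.
have CS : 'C(2 * k.+1, k.+1)%:R =
    2 * (2 * k%:R + 1) * 'C(2 * k, k)%:R / (k%:R + 1) :> rat.
  apply: (mulfI k1); rewrite [in LHS]natr1 -[LHS]natrM central_binS.
  by rewrite ![in LHS]natrM -(natr1 (2 * k)%N) natrM; field.
rewrite /weight CS mulnS exprD.
by field; rewrite C_neq0 k1 k21.
Qed.

Lemma harmonicS (k : nat) : harmonic k.+1 = harmonic k + (k%:R + 1)^-1.
Proof. by rewrite /harmonic big_nat_recr //= natr1. Qed.

Lemma U0n (e : nat) : U e 0 = 0.
Proof. by rewrite /U big_geq. Qed.

Lemma V0n (e : nat) : V e 0 = 0.
Proof. by rewrite /V big_geq. Qed.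

Lemma US (e n : nat) : U e n.+1 = U e n + weight n.+1 * (n%:R + 1) ^+ e.
Proof. by rewrite /U big_nat_recr //= natr1. Qed.

Lemma VS (e n : nat) :
  V e n.+1 = V e n + weight n.+1 * (n%:R + 1) ^+ e * harmonic n.+1.
Proof. by rewrite /V big_nat_recr //= natr1. Qed.

(** At [x = k] this is the polynomial factor of the increment, less its [k^d] part, which moves to
    the left of the recurrence for [V d]. *)
Lemma sum_c_expr (d : nat) (x : rat) :
  \sum_(1 <= j < d.+1) (-1) ^+ j * c d j * x ^+ (d - j) =
    2 * (x + 1) * x ^+ d - (2 * x - 1) * (x - 1) ^+ d - (2 * d%:R + 3) * x ^+ d.
Proof.
have expand e : (x - 1) ^+ e = \sum_(j < e.+1) (-1) ^+ j * 'C(e, j)%:R * x ^+ (e - j).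
  rewrite exprBn; apply: eq_bigr => j _.
  by rewrite expr1n mulr1 -mulr_natr mulrAC.
have all_j : \sum_(0 <= j < d.+1) (-1) ^+ j * c d j * x ^+ (d - j) =
    2 * x ^+ d.+1 - (2 * x - 1) * (x - 1) ^+ d.
  (* Once the leading [2 x^(d+1)] cancels, the coefficient of [(-1)^j x^(d-j)] is
     [2 C(d+1, j+1) - C(d, j)], which is [c d j] by Pascal's rule. *)
  have -> : (2 * x - 1) * (x - 1) ^+ d = 2 * (x - 1) ^+ d.+1 + (x - 1) ^+ d.
    by rewrite exprS; ring.
  rewrite (expand d.+1) big_ord_recl bin0 subn0 (expand d) big_mkord.
  rewrite expr0 !mul1r mulrDr opprD opprD addrA addrA subrr add0r.
  rewrite mulr_sumr -!sumrN -big_split /=; apply: eq_bigr => j _.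
  by rewrite /bump /c add1n subSS exprS !binS !natrD; ring.
(* The term [j = 0] has [c d 0 = 2d + 1]; passing from [2 x^(d+1)] to [2 (x+1) x^d] adds the
   remaining 2 of [2d + 3]. *)
move: all_j; rewrite big_ltn // expr0 subn0 /c !bin1 -natr1 exprS => all_j.
rewrite (_ : \sum_(1 <= j < d.+1) _ = 2 * (x * x ^+ d) - (2 * x - 1) * (x - 1) ^+ d
  - 1 * (d%:R + 1 + d%:R) * x ^+ d); first by ring.
by rewrite -all_j addrC addKr.
Qed.

Lemma V_recurrence (d n : nat) : (0 < d)%N ->
  (2 * d%:R + 3) * V d n =
    2 * (n%:R + 1) * weight n * n%:R ^+ d * harmonic n.+1
    - (\sum_(1 <= j < d.+1) (-1) ^+ j * c d j * V (d - j) n) - 2 * U d n.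
Proof.
move=> d_gt0; elim: n => [|n IHn].
  (* The boundary term vanishes only because [0 < d] makes [0^d = 0]. *)
  rewrite V0n U0n expr0n eqn0Ngt d_gt0 big1 => [|j _]; last by rewrite V0n mulr0.
  by rewrite /=; ring.
have -> : \sum_(1 <= j < d.+1) (-1) ^+ j * c d j * V (d - j) n.+1 =
    \sum_(1 <= j < d.+1) (-1) ^+ j * c d j * V (d - j) n +
    weight n.+1 * harmonic n.+1 *
      \sum_(1 <= j < d.+1) (-1) ^+ j * c d j * (n%:R + 1) ^+ (d - j).
  rewrite mulr_sumr -big_split /=; apply: eq_bigr => j _.
  by rewrite VS; ring.
rewrite sum_c_expr addrK VS US mulrDr IHn -weightS (harmonicS n.+1) -(natr1 n).
have n2 : n%:R + 1 + 1 != 0 :> rat by rewrite !natr1 pnatr_eq0.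
(* With [n^d] and [(n+1)^d] made opaque, a rational identity is left. *)
move: (_ ^+ d) (_ ^+ d) => y z. by field.
Qed.

(** Since [0^0 = 1] spoils the boundary term at [d = 0], this case has its own induction; [-2/9]
    makes the right side vanish at [n = 0]. *)
Lemma V0_closed (n : nat) :
  V 0 n = - (2 / 9) + 2 / 3 * weight n
            * ((n%:R + 1) * harmonic n - (2 * n%:R - 1) / 3).
Proof.
elim: n => [|n IHn].
  by rewrite V0n weight0 /harmonic big_geq //; field.
have n1 : n%:R + 1 != 0 :> rat by rewrite natr1 pnatr_eq0.
have weightE : weight n = (2 * n%:R + 1) * weight n.+1 / (2 * (n%:R + 1)).
  by rewrite weightS; field.
rewrite VS IHn weightE (harmonicS n) -(natr1 n) expr0.
by field.
Qed.

Theorem theorem3p3 (d n : nat) (hd : (0 < d)%N) (hn : (0 < n)%N) :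
  (2 * d%:R + 3) * V d n =
    (n%:R + 1) * 2 ^+ (2 * n + 1) * n%:R ^+ d * harmonic n.+1
      / 'C(2 * n, n)%:R
    - (\sum_(1 <= j < d.+1) (-1) ^+ j * c d j * V (d - j) n)
    - 2 * U d n
  /\
  V 0 n =
    - (2 / 9) + 2 ^+ (2 * n + 1) / (3 * 'C(2 * n, n)%:R)
      * ((n%:R + 1) * harmonic n - (2 * n%:R - 1) / 3).
Proof.
split.
  rewrite V_recurrence // /weight exprD expr1.
  by congr (_ - _ - _); ring.
by rewrite V0_closed /weight exprD expr1 invfM; ring.
Qed.
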